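(* Let $k\geq 2$ be an integer and let $\mathcal{NC}_n^k$ be the property that a graph on $n$ vertices is not $k$-colorable. In the Avoider-Enforcer game on $K_n$, $$ \left(\frac{k-1}{k}\right)\frac{n^2}{4}-O(k)=\left\lfloor\frac{1}{2}\, t(n,k)\right\rfloor\leq \tau_E(\mathcal{NC}_n^k)\leq \left(\frac{k-1}{k}\right)\frac{n^2}{4}+o(n^2). $$ In addition, the last two inequalities, i.e. $\left\lfloor\frac{1}{2}\, t(n,k)\right\rfloor\leq \tau_E(\mathcal{NC}_n^k)\leq \left(\frac{k-1}{k}\right)\frac{n^2}{4}+o(n^2)$, hold if $k=1$.
   Context: Avoider-Enforcer game: two players, Avoider and Enforcer, alternately claim previously unclaimed edges of the complete graph $K_n$, one edge per turn; in each round each player claims exactly one edge, so after $r$ rounds each player has claimed exactly $r$ edges. Avoider's graph is the graph on the $n$ vertices of $K_n$ whose edges are those claimed by Avoider. Given a property $\mathcal{P}$ of graphs on $n$ vertices, Enforcer wants Avoider's graph to have property $\mathcal{P}$ as early as possible, and Avoider wants to prevent this for as many rounds as possible. $\tau_E(\mathcal{P})$ is the smallest integer $t$ such that Enforcer can win in $t$ rounds against any opponent, i.e. Enforcer has a strategy guaranteeing that Avoider's graph has property $\mathcal{P}$ within $t$ rounds (with $\tau_E(\mathcal{P})=\infty$ if there is no such $t$). $t(n,k)$ is the Turán number: the maximum number of edges in a graph on $n$ vertices with no copy of $K_{k+1}$. Asymptotics: $k$ is fixed and $n\to\infty$; the bound with $o(n^2)$ means that for every $\delta>0$ there is $n_0$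 such that for all $n\ge n_0$ the inequality holds with $o(n^2)$ replaced by $\delta n^2$. $O(k)$ denotes a quantity bounded in absolute value by an absolute constant times $k$. *)

(* Defs.v *)
From HB Require Import structures.
From mathcomp Require Import all_boot all_order all_algebra.
From mathcomp Require Import all_classical all_reals ereal.

Set Implicit Arguments.
Unset Strict Implicit.
Unset Printing Implicit Defensive.

Import Order.TTheory GRing.Theory Num.Theory.

(* A graph on the vertex set 'I_n is given by its edge set, a subset of K n;
   an edge is a two-element set of vertices. *)
Definition graph (n : nat) := {set {set 'I_n}}.

Definition K (n : nat) : graph n := [set e : {set 'I_n} | #|e| == 2].

Definition adj (n : nat) (G : graph n) (u v : 'I_n) : bool :=
  [set u; v] \in G.

Definition has_clique (m n : nat) (G : graph n) : bool :=
  [exists S : {set 'I_n}, (#|S| == m) &&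
     [forall u in S, forall v in S, (u != v) ==> adj G u v]].

Definition colorable (k n : nat) (G : graph n) : bool :=
  [exists c : {ffun 'I_n -> 'I_k},
     [forall u, forall v, adj G u v ==> (c u != c v)]].

Definition NC (k n : nat) : pred (graph n) := fun G => ~~ colorable k G.

(* For k >= 1 the maximum is over a nonempty family: the edgeless graph
   qualifies. *)
Definition turan (n k : nat) : nat :=
  \max_(G : graph n | (G \subset K n) && ~~ has_clique k.+1 G) #|G|.

Inductive player := Avoider | Enforcer.

Section Game.
Variables (n : nat) (first : player).

(* A play is the sequence of all edges claimed so far, in order.  Moves are
   numbered from 0, so round r consists of the moves 2r and 2r + 1. *)
Definition play := seq {set 'I_n}.

Definition avoider_turn (i : nat) : bool :=
  if first is Avoider then ~~ odd i else odd i.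

Definition legal_play (p : play) : bool := uniq p && all [in K n] p.

Definition avoider_graph (p : play) : graph n :=
  [set e in p | avoider_turn (index e p)].

Definition strategy := play -> {set 'I_n}.

Definition follows (s : strategy) (p : play) : Prop :=
  forall i, i < size p -> ~~ avoider_turn i -> nth finset.set0 p i = s (take i p).

Definition legal_strategy (s : strategy) : Prop :=
  forall p, legal_play p -> follows s p -> size p < #|K n| ->
    ~~ avoider_turn (size p) -> legal_play (rcons p (s p)).

(* Avoider is unrestricted: p ranges over all plays against s that last t
   rounds, or until the board is exhausted if this happens earlier. *)
Definition enforcer_wins (P : pred (graph n)) (t : nat) : Prop :=
  exists2 s : strategy, legal_strategy s &
    forall p, legal_play p -> follows s p -> size p = minn t.*2 #|K n| ->
      exists2 i, i <= size p & P (avoider_graph (take i p)).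

(* The infimum of the empty set is +oo. *)
Definition tau_E (R : realType) (P : pred (graph n)) : \bar R :=
  ereal_inf [set t%:R%:E | t in [set t | enforcer_wins P t]]%classic%R.

End Game.

(* Main.v *)
Require Import Defs.
From HB Require Import structures.
From mathcomp Require Import all_boot all_order all_algebra.
From mathcomp Require Import all_classical all_reals ereal.
From mathcomp Require Import fintype finset zify ring lra.

(** Both game bounds are about one family of graphs: for a colouring [c] of the
    vertices with [k] colours, let [multipartite c] be the complete
    multipartite graph of all edges with ends of different colours.  A graph is
    [k]-colourable iff it is a subgraph of some [multipartite c]
    ([colorableE]).

    Turan's theorem.  The number [turan n k] is attained by some
    [multipartite c] ([turan_attained]).  This is Erdos' degree majorization
    ([degree_majorization]): for a graph without a clique on [k + 1] vertices,
    put outside the neighbourhood of a vertex of maximum degree a single new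
    colour, and colour the neighbourhood by induction; no degree goes down when
    the graph is replaced by the complete multipartite graph of this colouring.
    Counting with the sizes of the colour classes then gives the numerical
    estimates: the upper bound is the Cauchy-Schwarz inequality for the class
    sizes ([turan_ub]), the lower bound comes from colouring [u] by its residue
    modulo [k] ([turan_lb]).

    Lower bound on the length of the game.  Avoider fixes a [multipartite c]
    with [turan n k] edges and only claims edges of it.  One is free as
    long as fewer than [turan n k] edges have been claimed in all
    ([play_inside]), and his graph stays [k]-colourable meanwhile ([enforcer_wins_lb]).

    Upper bound.  Call a colouring [c] alive if Avoider's graph is still a
    subgraph of [multipartite c], and give it the weight [2 ^ m], where [m] is
    the number of claimed edges outside [multipartite c]; these all belong to
    Enforcer.  The potential is the total weight of the colourings alive, at
    first at most [k ^ n].  If Enforcer claims [e], the potential grows by the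
    weight of the colourings for which [e] is monochromatic (the danger of
    [e]); if Avoider claims [f], it drops by the danger of [f].  Enforcer always
    claims a free edge of least danger.  As dangers only grow with his move,
    Avoider's answer compensates for it, so the potential never exceeds
    [2 * k ^ n] ([potential_invariant]).  After [t] rounds at least
    [t.*2 - turan n k] claimed edges are outside any given [multipartite c], so
    a colouring alive would have weight at least [2 ^ (t.*2 - turan n k)],
    which is too large once [t.*2] exceeds [turan n k + k * n + 1]
    ([enforcer_wins_ub]).  The error is thus even linear in [n]. *)

Set Implicit Arguments.
Unset Strict Implicit.
Unset Printing Implicit Defensive.

Import Order.TTheory GRing.Theory Num.Theory.
Local Open Scope nat_scope.

(** * Complete multipartite graphs and colourability *)

(** The complete multipartite graph whose parts are the colour classes of [c]:
    the edges with ends of two different colours.  Colour classes may be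
    empty. *)
Definition multipartite (k n : nat) (c : {ffun 'I_n -> 'I_k}) : graph n :=
  [set e in K n | #|c @: e| == 2].

Lemma pair_in_K (n : nat) (u v : 'I_n) : ([set u; v] \in K n) = (u != v).
Proof. by rewrite inE cards2; case: (u != v). Qed.

Lemma K_pairP (n : nat) (e : {set 'I_n}) :
  reflect (exists u v, u != v /\ e = [set u; v]) (e \in K n).
Proof.
by rewrite inE; exact: cards2P.
Qed.

Lemma multipartite_subK (k n : nat) (c : {ffun 'I_n -> 'I_k}) :
  multipartite c \subset K n.
Proof. by apply/subsetP => e; rewrite inE => /andP[]. Qed.

Lemma adj_multipartite (k n : nat) (c : {ffun 'I_n -> 'I_k}) (u v : 'I_n) :
  adj (multipartite c) u v = (c u != c v).
Proof.
rewrite /adj /multipartite inE pair_in_K imsetU1 imset_set1 cards2.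
by case: (eqVneq u v) => [->|_]; rewrite ?eqxx //=; case: (c u != c v).
Qed.

Lemma colorableE (k n : nat) (G : graph n) : G \subset K n ->
  colorable k G = [exists c : {ffun 'I_n -> 'I_k}, G \subset multipartite c].
Proof.
move=> /subsetP GK; apply: eq_existsb => c; apply/idP/idP.
  move=> /forallP cP; apply/subsetP => e eG.
  have /K_pairP [u [v [_ def_e]]] := GK e eG; rewrite def_e in eG *.
  by have /forallP/(_ v)/implyP/(_ eG) := cP u; rewrite -adj_multipartite.
move=> /subsetP GM; apply/forallP => u; apply/forallP => v.
by apply/implyP => /GM; rewrite -adj_multipartite.
Qed.

Lemma handshake (n : nat) (G : graph n) : G \subset K n ->
  \sum_(u < n) #|[set v | adj G u v]| = 2 * #|G|.
Proof.
move=> /subsetP GK.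
transitivity (\sum_(u < n) \sum_(e in G) (u \in e : nat)).
  apply: eq_bigr => u _.
  rewrite -big_mkcondr /= sum1dep_card.
  rewrite -(card_in_imset (f := fun v => [set u; v])).
    apply: eq_card => e; rewrite inE; apply/imsetP/andP => [[v]|[eG ue]].
      by rewrite inE => vG ->; rewrite set21.
    have /K_pairP [a [b [_ def_e]]] := GK e eG.
    move: ue eG; rewrite def_e !inE => /orP[] /eqP -> eG.
      by exists b; rewrite ?inE.
    by exists a; rewrite ?inE /adj setUC.
  move=> v w; rewrite !inE => /GK; rewrite pair_in_K => uv /GK.
  rewrite pair_in_K => uw /setP /(_ v).
  by rewrite set22 !inE eq_sym (negPf uv) => /esym/eqP.
rewrite exchange_big /= -sum1_card big_distrr /=; apply: eq_bigr => e eG.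
rewrite -big_mkcond /= sum1_card muln1.
by have := GK e eG; rewrite inE => /eqP.
Qed.

(** * Turan's theorem *)

(** Erdos' form of Turan's theorem, relative to a subset [A] of the vertices so
    as to be proved by induction on [k].  Only the colours of the elements of
    [A] matter. *)
Lemma degree_majorization (T : finType) (r : rel T) (k : nat) (A : {set T}) :
  symmetric r -> irreflexive r ->
  (forall S : {set T}, S \subset A -> #|S| = k.+1 ->
     ~~ [forall u in S, forall v in S, (u != v) ==> r u v]) ->
  exists c : T -> nat, (forall v, v \in A -> c v < k) /\
    (forall v, v \in A ->
       #|[set u in A | r v u]| <= #|[set u in A | c v != c u]|).
Proof.
move=> r_sym r_irr; elim: k A => [|k IHk] A noClique.
  exists (fun=> 0); have A0 v : v \in A -> False.
    move=> vA; have := noClique [set v]; rewrite sub1set cards1.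
    move=> /(_ vA erefl) /negP; apply; apply/forall_inP => x /set1P ->.
    by apply/forall_inP => y /set1P ->; rewrite eqxx.
  by split=> v /A0.
have [->|[v0 v0A]] := set_0Vmem A.
  by exists (fun=> 0); split=> v; rewrite inE.
pose deg v := #|[set u in A | r v u]|.
(* B is the neighbourhood of a vertex v of maximum degree; the vertices of
   A :\: B receive the new colour k *)
case: (@arg_maxnP T v0 (mem A) deg v0A) => v vA0 v_max.
have vA : v \in A by [].
pose B := [set u in A | r v u].
have inB u : (u \in B) = (u \in A) && r v u by rewrite inE.
have cardB : #|B| = deg v by [].
move: B inB cardB => B inB cardB.
have BA : B \subset A by apply/subsetP => u; rewrite inB => /andP[].
have vB : v \notin B by rewrite inB r_irr andbF.
have [|c [c_lt c_deg]] := IHk B.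
  move=> S SB Sk; apply/negP => /forall_inP Scl.
  have vS : v \notin S by apply: contra vB => /(subsetP SB).
  have := noClique (v |: S); rewrite cardsU1 vS Sk => /(_ _ erefl).
  rewrite subUset sub1set vA (subset_trans SB BA) => /(_ isT) /negP[].
  have rvS x : x \in S -> r v x.
    by move=> /(subsetP SB); rewrite inB => /andP[].
  apply/forall_inP => x /setU1P[->|xS]; apply/forall_inP => y /setU1P[->|yS].
  - by rewrite eqxx.
  - by rewrite rvS // implybT.
  - by rewrite r_sym rvS // implybT.
  - by have /forall_inP/(_ y yS) := Scl x xS.
exists (fun u => if u \in B then c u else k); split=> [w wA | w wA].
  by case: ifP => [/c_lt/ltnW|].
case: ifPn => wB.
  (* neighbours of w inside B are counted by induction, the other ones lie in
     A :\: B, all of whose vertices have a colour different from that of w *)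
  have lt_ck := c_lt w wB.
  apply: (@leq_trans (#|[set u in B | r w u]| + #|A :\: B|)).
    rewrite -cardsUI; apply: leq_trans (leq_addr _ _); apply: subset_leq_card.
    apply/subsetP => u; rewrite !inE => /andP[-> ->].
    by case: (u \in B).
  apply: (@leq_trans (#|[set u in B | c w != c u]| + #|A :\: B|)).
    by rewrite leq_add2r c_deg.
  rewrite -cardsUI [X in _ + X](_ : _ = 0) ?addn0; last first.
    apply/eqP; rewrite cards_eq0; apply/eqP/setP => u; rewrite !inE.
    by case: (u \in B); rewrite ?andbF.
  apply: subset_leq_card; apply/subsetP => u; rewrite !inE.
  case: ifP => [uB|_] /=; first by rewrite orbF (subsetP BA).
  by move=> ->; rewrite neq_ltn lt_ck.
(* the vertices of another colour than w form the set B, of size deg v *)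
apply: leq_trans (v_max w wA) _; rewrite -cardB; apply: subset_leq_card.
apply/subsetP => u uB; rewrite inE (subsetP BA) //= uB.
by rewrite neq_ltn c_lt // orbT.
Qed.

Lemma multipartite_clique_free (n m : nat) (G : graph n)
    (c : {ffun 'I_n -> 'I_m}) :
  G \subset multipartite c -> ~~ has_clique m.+1 G.
Proof.
move=> /subsetP GM; apply/negP => /existsP[S /andP[/eqP Sm /forall_inP Scl]].
have c_inj : {in S &, injective c}.
  move=> u v uS vS cuv; apply/eqP; apply: contraT => uv.
  have /forall_inP/(_ v vS)/implyP/(_ uv)/GM := Scl u uS.
  by rewrite -/(adj _ _ _) adj_multipartite cuv eqxx.
by have := max_card (mem (c @: S)); rewrite card_in_imset // Sm card_ord ltnn.
Qed.

Lemma card_multipartite_le_turan (k n : nat) (c : {ffun 'I_n -> 'I_k}) :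
  #|multipartite c| <= turan n k.
Proof.
apply: (leq_bigmax_cond (F := fun G : graph n => #|G|)).
by rewrite multipartite_subK (multipartite_clique_free (subxx _)).
Qed.

Lemma turan_attained (k n : nat) : 0 < k ->
  exists c : {ffun 'I_n -> 'I_k}, #|multipartite c| = turan n k.
Proof.
case: k => // k _.
have clique0 : ~~ has_clique k.+2 (set0 : graph n).
  apply: (@multipartite_clique_free _ _ _ [ffun=> ord0]).
  exact: sub0set.
have [|G] := @eq_bigmax_cond _
    [pred G : graph n | (G \subset K n) && ~~ has_clique k.+2 G] (fun G => #|G|).
  by apply/card_gt0P; exists set0; rewrite inE sub0set clique0.
rewrite inE => /andP[GK Gcl] maxG.
have {maxG} turanE : turan n k.+1 = #|G|.
  by rewrite -maxG; apply: eq_bigl => H; rewrite inE.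
have adj_sym : symmetric (adj G) by move=> u v; rewrite /adj setUC.
have adj_irr : irreflexive (adj G).
  move=> u; apply/negP => /(subsetP GK).
  by rewrite pair_in_K eqxx.
have [|c [c_lt c_deg]] := @degree_majorization _ (adj G) k.+1 [set: 'I_n] adj_sym adj_irr.
  move=> S _ Sk; apply: contra Gcl => Scl.
  by apply/existsP; exists S; rewrite Sk eqxx.
pose d := [ffun u => inord (c u)] : {ffun 'I_n -> 'I_k.+1}.
have dE u v : (d u == d v) = (c u == c v).
  by rewrite !ffunE -val_eqE /= !inordK ?c_lt ?inE.
exists d; apply/eqP; rewrite eqn_leq card_multipartite_le_turan turanE -(@leq_pmul2l 2) //.
rewrite -!handshake ?multipartite_subK //; apply: leq_sum => u _.
have := c_deg u (in_setT u); congr (_ <= _); apply: eq_card => v; rewrite !inE //.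
by rewrite adj_multipartite dE.
Qed.

Definition class_size (k n : nat) (c : {ffun 'I_n -> 'I_k}) (i : 'I_k) : nat :=
  #|[set u | c u == i]|.

Section Counting.
Variables (k n : nat) (c : {ffun 'I_n -> 'I_k}).
Local Notation a := (class_size c).

Lemma sum_classes : \sum_i a i = n.
Proof.
rewrite -[RHS]card_ord -sum1_card (partition_big c predT) //=.
by apply: eq_bigr => i _; rewrite sum1dep_card.
Qed.

Lemma card_multipartite : 2 * #|multipartite c| + \sum_i a i ^ 2 = n ^ 2.
Proof.
rewrite -handshake ?multipartite_subK //.
have -> : \sum_i a i ^ 2 = \sum_u a (c u).
  rewrite (partition_big c predT) //=; apply: eq_bigr => i _.
  rewrite [RHS](eq_bigr (fun=> a i)) => [|u /eqP -> //].
  by rewrite sum_nat_cond_const -mulnn.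
rewrite -big_split /= (eq_bigr (fun=> n)) ?sum_nat_const ?card_ord ?mulnn //.
move=> u _; rewrite -[RHS](card_ord n) -(cardsC [set v | adj (multipartite c) u v]).
congr (_ + _); apply: eq_card => v.
by rewrite !inE adj_multipartite negbK eq_sym.
Qed.

Lemma cauchy_classes : n ^ 2 <= k * \sum_i a i ^ 2.
Proof.
rewrite -(leq_pmul2l (isT : 0 < 2)) -[in n ^ 2]sum_classes -mulnn.
rewrite big_distrlr /= big_distrr /=.
have -> : 2 * (k * \sum_i a i ^ 2) = \sum_i \sum_j (a i ^ 2 + a j ^ 2).
  under [RHS]eq_bigr => i _ do rewrite big_split /= sum_nat_const card_ord.
  by rewrite big_split /= -big_distrr /= sum_nat_const card_ord addnn -mul2n.
apply: leq_sum => i _; rewrite big_distrr /=; apply: leq_sum => j _.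
exact: nat_Cauchy.
Qed.

Lemma card_multipartite_ub : 2 * k * #|multipartite c| + n ^ 2 <= k * n ^ 2.
Proof.
have := cauchy_classes; have := card_multipartite; nia.
Qed.

End Counting.

Lemma card_residue (k n i : nat) : i < k ->
  \sum_(u < n) (u %% k == i) = n %/ k + (i < n %% k).
Proof.
move=> ik; have k0 : 0 < k by apply: leq_ltn_trans ik.
elim: n => [|n IHn]; first by rewrite big_ord0 div0n mod0n.
rewrite big_ord_recr /= IHn.
have := divn_eq n k; have := ltn_pmod n k0; set r := n %% k; set q := n %/ k.
move=> rk def_n.
case: (eqVneq r.+1 k) => [rk1|rk1].
  have e : n.+1 = q.+1 * k by rewrite def_n; nia.
  rewrite e mulnK // modnMl ltn0 addn0; lia.
have e : n.+1 = q * k + r.+1 by lia.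
have rk2 : r.+1 < k by lia.
rewrite e divnMDl // modnMDl (divn_small rk2) (modn_small rk2); lia.
Qed.

Lemma turan_ub (k n : nat) : 0 < k -> 2 * k * turan n k + n ^ 2 <= k * n ^ 2.
Proof.
by move=> /(@turan_attained k n)[c <-]; apply: card_multipartite_ub.
Qed.

Lemma turan_lb (k n : nat) : 0 < k ->
  k * n ^ 2 <= 2 * k * turan n k + n ^ 2 + k ^ 2.
Proof.
case: k => // k _.
pose c := [ffun u : 'I_n => inord (u %% k.+1)] : {ffun 'I_n -> 'I_k.+1}.
have aE (i : 'I_k.+1) : class_size c i = n %/ k.+1 + (i < n %% k.+1).
  rewrite /class_size -card_residue // -sum1_card big_mkcond /=; apply: eq_bigr => u _.
  by rewrite inE ffunE -val_eqE /= inordK ?ltn_pmod //; case: eqP.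
have := card_multipartite_le_turan c.
have := card_multipartite c.
under eq_bigr => i _ do rewrite aE.
have -> : \sum_(i < k.+1) (n %/ k.+1 + (i < n %% k.+1)) ^ 2 =
   k.+1 * (n %/ k.+1) ^ 2 + (2 * (n %/ k.+1) + 1) * (n %% k.+1).
  have r_le : n %% k.+1 <= k.+1 by rewrite ltnW // ltn_pmod.
  have cardr : \sum_(i < k.+1) (i < n %% k.+1) = n %% k.+1.
    rewrite -big_mkcond /= sum1_card -[RHS]card_ord.
    rewrite -(card_image (f := widen_ord r_le)); last first.
      by move=> x y /(congr1 val) /= /val_inj.
    apply: eq_card => x; apply/idP/imageP => [xr|[y _ ->]]; last exact: ltn_ord y.
    by exists (Ordinal (xr : x < n %% k.+1)) => //; apply: val_inj.
  rewrite -[in RHS]cardr big_distrr /= -[X in X * _](card_ord k.+1).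
  rewrite -sum_nat_const -big_split /=; apply: eq_bigr => i _.
  by case: (_ < _); rewrite ?addn0 ?muln0 ?muln1 ?addn0 //; lia.
have := divn_eq n k.+1; have := ltn_pmod n (ltn0Sn k).
move: (n %/ k.+1) (n %% k.+1) (turan n k.+1) #|_| => q r t m rk ->.
nia.
Qed.

(** * Plays, and the lower bound *)

Lemma avoider_turnS (first : player) (i : nat) :
  avoider_turn first i.+1 = ~~ avoider_turn first i.
Proof. by case: first => /=; rewrite ?negbK. Qed.

Lemma legal_play_rcons (n : nat) (p : play n) (e : {set 'I_n}) :
  legal_play (rcons p e) = [&& legal_play p, e \in K n & e \notin p].
Proof.
rewrite /legal_play rcons_uniq all_rcons /=.
by case: (e \in K n); case: (e \in p); rewrite /= ?andbF ?andbT.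
Qed.

Lemma follows_rcons (n : nat) (first : player) (s : strategy n) (p : play n)
    (e : {set 'I_n}) :
  follows first s (rcons p e) <->
  follows first s p /\ (~~ avoider_turn first (size p) -> e = s p).
Proof.
split=> [fol|[fol last_e] i].
  split=> [i ip i_turn|p_turn].
    have := fol i; rewrite size_rcons nth_rcons ip -cats1 takel_cat ?(ltnW ip) //.
    by apply => //; rewrite ltnW.
  have := fol (size p); rewrite size_rcons nth_rcons ltnn eqxx -cats1 take_size_cat //.
  exact.
rewrite size_rcons ltnS leq_eqVlt => /orP[/eqP -> turn|ip turn].
  by rewrite nth_rcons ltnn eqxx -cats1 take_size_cat // last_e.
by rewrite nth_rcons ip -cats1 takel_cat ?(ltnW ip) // fol.
Qed.

Lemma avoider_graph_nil (n : nat) (first : player) :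
  avoider_graph first (@nil {set 'I_n}) = set0.
Proof. by apply/setP => e; rewrite !inE. Qed.

Lemma avoider_graph_rcons (n : nat) (first : player) (p : play n)
    (e : {set 'I_n}) : e \notin p ->
  avoider_graph first (rcons p e) =
    if avoider_turn first (size p) then e |: avoider_graph first p
    else avoider_graph first p.
Proof.
move=> ep; apply/setP => f.
have -> : (f \in avoider_graph first (rcons p e)) =
          if f == e then avoider_turn first (size p)
          else f \in avoider_graph first p.
  rewrite inE mem_rcons inE -cats1 index_cat.
  case: (eqVneq f e) => [->|fe] /=; first by rewrite (negPf ep) /= eqxx addn0.
  by rewrite inE; case: (f \in p).
case turn: (avoider_turn first (size p)).
  by rewrite in_setU1; case: (eqVneq f e).
by case: (eqVneq f e) => [->|//]; rewrite inE (negPf ep).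
Qed.

Lemma avoider_graph_take (n : nat) (first : player) (p : play n) (i : nat) :
  uniq p -> avoider_graph first (take i p) \subset avoider_graph first p.
Proof.
move=> p_uniq; apply/subsetP => e; rewrite !inE => /andP[ei].
rewrite (mem_take ei) /= -[in X in _ -> X](cat_take_drop i p) index_cat ei.
by [].
Qed.

Lemma avoider_graph_subK (n : nat) (first : player) (p : play n) :
  legal_play p -> avoider_graph first p \subset K n.
Proof.
move=> /andP[_ /allP pK]; apply/subsetP => e; rewrite inE => /andP[/pK]. by [].
Qed.

Lemma free_edge (n : nat) (G : graph n) (p : play n) : size p < #|G| ->
  exists2 e, e \in G & e \notin p.
Proof.
move=> pG; have : ~~ (G \subset p).
  apply/negP => /subset_leq_card; rewrite leqNgt => /negP[].
  exact: leq_ltn_trans (card_size p) pG.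
by move=> /subsetPn.
Qed.

(** Avoider's strategy of claiming edges of [G] only: it can be kept up against
    any strategy of Enforcer for [#|G|] moves of both players together. *)
Lemma play_inside (n : nat) (first : player) (G : graph n) (s : strategy n)
    (m : nat) :
  G \subset K n -> legal_strategy first s -> m <= #|G| ->
  exists p, [/\ legal_play p, follows first s p, size p = m &
                avoider_graph first p \subset G].
Proof.
move=> GK s_legal; elim: m => [_|m IHm mG].
  by exists [::]; split=> //; rewrite avoider_graph_nil sub0set.
have [p [p_legal p_fol pm pG]] := IHm (ltnW mG); rewrite -pm in mG.
case turn : (avoider_turn first (size p)).
  have [e eG ep] := free_edge mG; exists (rcons p e); split.
  - by rewrite legal_play_rcons p_legal (subsetP GK) // ep.
  - by apply/follows_rcons; rewrite turn.
  - by rewrite size_rcons pm.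
  - by rewrite avoider_graph_rcons // turn subUset sub1set eG.
have mK : size p < #|K n| by apply: leq_trans mG (subset_leq_card GK).
have := s_legal p p_legal p_fol mK (negbT turn).
set e := s p => pe_legal; exists (rcons p e); split=> //.
- by apply/follows_rcons.
- by rewrite size_rcons pm.
- move: pe_legal; rewrite legal_play_rcons => /and3P[_ _ ep].
  by rewrite avoider_graph_rcons // turn.
Qed.

Lemma enforcer_wins_lb (k n : nat) (first : player) (t : nat) : 0 < k ->
  enforcer_wins first (@NC k n) t -> (turan n k)./2 <= t.
Proof.
move=> k0 [s s_legal s_wins]; rewrite leqNgt; apply/negP => t_lt.
have [c cE] := turan_attained n k0.
have cK := multipartite_subK c.
have t_le : t.*2 <= #|multipartite c| by rewrite cE; lia.
have [p [p_legal p_fol pt pc]] := play_inside cK s_legal t_le.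
have := s_wins p p_legal p_fol.
rewrite pt (minn_idPl (leq_trans t_le (subset_leq_card cK))) => /(_ erefl)[i _].
have /andP[p_uniq _] := p_legal.
have pi_c := subset_trans (avoider_graph_take first i p_uniq) pc.
rewrite /NC colorableE ?(subset_trans pi_c) // => /existsP[].
by exists c.
Qed.

(** * Enforcer's strategy, and the upper bound *)

Section Potential.
Variables (k n : nat) (first : player).
Implicit Types (p : play n) (c : {ffun 'I_n -> 'I_k}) (e f : {set 'I_n}).

(** Two to the number of claimed edges that are monochromatic under [c].  All
    the claimed edges count; when [c] is alive these ones are Enforcer's. *)
Definition weight c p : nat := 2 ^ count [predC multipartite c] p.

(** [c] is a proper colouring of Avoider's graph. *)
Definition alive c p : bool := avoider_graph first p \subset multipartite c.

Definition potential p : nat := \sum_(c | alive c p) weight c p.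

(** The weight of the colourings that would be lost if Avoider claimed [e], and
    would double if Enforcer claimed it. *)
Definition danger p e : nat :=
  \sum_(c | alive c p && (e \notin multipartite c)) weight c p.

Lemma weight_rcons c p e : weight c (rcons p e) =
  (if e \in multipartite c then 1 else 2) * weight c p.
Proof.
rewrite /weight -cats1 count_cat /= addn0 inE -topredE /=.
by case: ifP => _ /=; rewrite ?addn0 ?mul1n // addn1 expnS.
Qed.

Lemma alive_rcons c p e : e \notin p -> alive c (rcons p e) =
  alive c p && (avoider_turn first (size p) ==> (e \in multipartite c)).
Proof.
move=> ep; rewrite /alive avoider_graph_rcons //.
by case: ifP => _; rewrite ?andbT // subUset sub1set andbC.
Qed.

Lemma potential_avoider p e : e \notin p -> avoider_turn first (size p) ->
  potential (rcons p e) + danger p e = potential p.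
Proof.
move=> ep turn; rewrite /potential /danger.
rewrite [RHS](bigID (fun c => e \in multipartite c)) /=; congr (_ + _).
under eq_bigl => c do rewrite alive_rcons // turn /=.
by apply: eq_bigr => c /andP[_ ec]; rewrite weight_rcons ec mul1n.
Qed.

Lemma potential_enforcer p e : e \notin p -> ~~ avoider_turn first (size p) ->
  potential (rcons p e) = potential p + danger p e.
Proof.
move=> ep turn; rewrite /potential /danger.
under eq_bigl => c do rewrite alive_rcons // (negPf turn) /= andbT.
rewrite (bigID (fun c => e \in multipartite c)) /=.
rewrite [in RHS](bigID (fun c => e \in multipartite c)) /= -addnA; congr (_ + _).
  by apply: eq_bigr => c /andP[_ ec]; rewrite weight_rcons ec mul1n.
rewrite addnn -mul2n big_distrr /=; apply: eq_bigr => c /andP[_ ec].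
by rewrite weight_rcons (negPf ec).
Qed.

Lemma danger_le_potential p e : danger p e <= potential p.
Proof.
rewrite /potential (bigID (fun c => e \in multipartite c)) /=.
exact: leq_addl.
Qed.

Lemma danger_enforcer p e f : e \notin p -> ~~ avoider_turn first (size p) ->
  danger p f <= danger (rcons p e) f.
Proof.
move=> ep turn; rewrite /danger.
under [leqRHS]eq_bigl => c do rewrite alive_rcons // (negPf turn) /= andbT.
apply: leq_sum => c _; rewrite weight_rcons.
by case: ifP; rewrite ?mul1n // leq_pmull.
Qed.

Definition unclaimed p : pred {set 'I_n} := [pred e in K n | e \notin p].

(** Claim a free edge of least danger.  The value [set0] is irrelevant: it is
    only taken on a full board. *)
Definition enforcer_strategy : strategy n := fun p =>
  if [pick e | unclaimed p e] is Some e0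
  then [arg min_(e < e0 | unclaimed p e) danger p e] else set0.

Lemma enforcer_strategyP p : size p < #|K n| ->
  unclaimed p (enforcer_strategy p) /\
  (forall f, unclaimed p f -> danger p (enforcer_strategy p) <= danger p f).
Proof.
move=> /free_edge [e0 e0K e0p]; rewrite /enforcer_strategy.
case: pickP => [e1 e1p|/(_ e0)]; last by rewrite /unclaimed /= e0K e0p.
by case: arg_minnP.
Qed.

Lemma enforcer_strategy_legal : legal_strategy first enforcer_strategy.
Proof.
move=> p p_legal _ /enforcer_strategyP[/andP[eK ep] _] _.
by rewrite legal_play_rcons p_legal eK.
Qed.

(** On Avoider's turns, the second bound says that any answer of his brings the
    potential back to at most [k ^ n]. *)
Lemma potential_invariant p :
  legal_play p -> follows first enforcer_strategy p ->
  if avoider_turn first (size p)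
  then potential p <= 2 * k ^ n /\
       forall f, unclaimed p f -> potential p <= k ^ n + danger p f
  else potential p <= k ^ n.
Proof.
elim/last_ind: p => [|p e IHp].
  have potential0 : potential [::] <= k ^ n.
    rewrite /potential sum_nat_cond_const muln1.
    apply: leq_trans (max_card _) _.
    by rewrite card_ffun !card_ord.
  move=> _ _; case: ifP => _ //; split=> [|f _].
    by apply: leq_trans potential0 _; rewrite leq_pmull.
  exact: leq_trans potential0 (leq_addr _ _).
rewrite legal_play_rcons => /and3P[p_legal eK ep] /follows_rcons[p_fol es].
have {IHp} := IHp p_legal p_fol; rewrite size_rcons avoider_turnS.
have e_free : unclaimed p e by rewrite /unclaimed /= eK ep.
case: (boolP (avoider_turn first (size p))) => turn /= IHp.
  have [_ /(_ e e_free)] := IHp.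
  by rewrite -(potential_avoider ep turn) leq_add2r.
have p_lt : size p < #|K n|.
  have : uniq (rcons p e) by rewrite rcons_uniq ep; case/andP: p_legal.
  move=> /card_uniqP; rewrite size_rcons => <-; apply: subset_leq_card.
  apply/subsetP => f; rewrite mem_rcons inE => /orP[/eqP -> //|].
  by case/andP: p_legal => _ /allP; apply.
rewrite potential_enforcer //; split=> [|f /andP[fK]].
  by rewrite mul2n -addnn leq_add // (leq_trans (danger_le_potential _ _)).
rewrite mem_rcons inE negb_or => /andP[_ fp].
rewrite leq_add // (leq_trans _ (danger_enforcer _ ep turn)) //.
have [_ e_min] := enforcer_strategyP p_lt.
by rewrite (es turn) e_min // /unclaimed /= fK fp.
Qed.

Lemma enforcer_wins_ub (t : nat) :
  t.*2 <= #|K n| -> turan n k + k * n + 1 < t.*2 ->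
  enforcer_wins first (@NC k n) t.
Proof.
move=> tK t_gt; exists enforcer_strategy; first exact: enforcer_strategy_legal.
move=> p p_legal p_fol; rewrite (minn_idPl tK) => p_size.
exists (size p) => //; rewrite take_size /NC colorableE ?avoider_graph_subK //.
apply/existsP => -[c c_alive].
have p_le : potential p <= 2 * k ^ n.
  have := potential_invariant p_legal p_fol; case: ifP => _ [] // H.
  by apply: leq_trans H _; rewrite leq_pmull.
have w_le : weight c p <= 2 * k ^ n.
  by apply: leq_trans p_le; rewrite /potential (bigD1 c) // leq_addr.
(* the weight of c is too large: at most turan n k of the claimed edges are
   inside multipartite c *)
have in_le : count [in multipartite c] p <= turan n k.
  apply: leq_trans (card_multipartite_le_turan c); case/andP: p_legal => p_uniq _.
  rewrite -size_filter -(card_uniqP (filter_uniq _ p_uniq)).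
  by apply: subset_leq_card; apply/subsetP => f; rewrite mem_filter => /andP[].
have count_p : count [in multipartite c] p + count [predC multipartite c] p =
  size p := count_predC _ _.
have kn_lt : 2 * k ^ n < 2 ^ (k * n + 2).
  have kn_le : k ^ n <= 2 ^ (k * n).
    by rewrite expnM; case: (n) => // m; rewrite leq_exp2r // ltnW // ltn_expl.
  have := expn_gt0 2 (k * n); rewrite expnD /=; lia.
have : 2 ^ (k * n + 2) <= weight c p.
  rewrite leq_exp2l //; lia.
lia.
Qed.

End Potential.

(** * Real estimates *)

Lemma card_K (n : nat) : 2 * #|K n| + n = n ^ 2.
Proof.
have -> : #|K n| = 'C(n, 2) by rewrite card_draws card_ord.
by rewrite mulnC -[in X in _ * X]/(2`!) bin_ffact ffactnS ffactn1; nia.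
Qed.

Local Open Scope ring_scope.

Lemma turan_real_bounds (R : realType) (k n : nat) : (0 < k)%N ->
  0 <= ((k%:R - 1) / k%:R * (n%:R ^+ 2 / 2) - (turan n k)%:R : R) <= k%:R / 2.
Proof.
move=> k0; have kR : 0 < k%:R :> R by rewrite ltr0n.
have := turan_ub n k0; rewrite -(ler_nat R) !natrD !natrX !natrM => ub.
have := turan_lb n k0; rewrite -(ler_nat R) !natrD !natrX !natrM => lb.
have E : (k%:R - 1) / k%:R * (n%:R ^+ 2 / 2) - (turan n k)%:R =
  (k%:R * n%:R ^+ 2 - n%:R ^+ 2 - 2 * k%:R * (turan n k)%:R) / (2 * k%:R) :> R.
  by field; rewrite gt_eqF.
have k2 : 0 < 2 * k%:R :> R by rewrite mulr_gt0.
rewrite E; apply/andP; split; first by rewrite divr_ge0 ?(ltW k2) //; lra.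
by rewrite ler_pdivrMr //; nra.
Qed.

Lemma half_bounds (R : realType) (m : nat) :
  m%:R - 1 <= (2 * (m./2)%:R : R) <= m%:R.
Proof.
have m_le : (m <= 2 * m./2 + 1)%N by lia.
have le_m : (2 * m./2 <= m)%N by lia.
move: m_le le_m; rewrite -!(ler_nat R) natrD natrM; lra.
Qed.

Theorem theorem3 (R : realType) :
  (exists C : R, forall k n : nat, (2 <= k)%N ->
     `| (k%:R - 1) / k%:R * (n%:R ^+ 2 / 4) - ((turan n k)./2)%:R | <= C * k%:R)
  /\
  (forall (k : nat) (first : player), (1 <= k)%N ->
     (forall n : nat,
        (((turan n k)./2)%:R%:E <= tau_E first R (@NC k n))%E)
     /\
     (forall delta : R, 0 < delta ->
        exists n0 : nat, forall n : nat, (n0 <= n)%N ->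
          (tau_E first R (@NC k n) <=
             ((k%:R - 1) / k%:R * (n%:R ^+ 2 / 4) + delta * n%:R ^+ 2)%:E)%E)).
Proof.
split.
  exists 1 => k n k2.
  have kR : 2 <= k%:R :> R by rewrite ler_nat.
  have /andP[lb ub] := turan_real_bounds R n (ltnW k2).
  have /andP[hlb hub] := half_bounds R (turan n k).
  rewrite ler_norml; move: lb ub; set a := (_ - 1) / _; set b := n%:R ^+ 2 => lb ub.
  by apply/andP; split; lra.
move=> k first k0; split=> [n|delta delta0].
  apply: le_ereal_inf_tmp => _ [t /= t_wins <-].
  by rewrite lee_fin ler_nat (enforcer_wins_lb k0 t_wins).
pose M := Num.bound ((k%:R / 2 + 2) / delta).
(* n > M makes k n / 2 + 2 at most delta n ^ 2, and n >= 2 k (k + 5) makes the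
   board large enough for t rounds *)
exists (M + 2 * k * (k + 5) + 1)%N => n n_large.
pose t := ((turan n k + k * n + 4)./2)%N.
have t_bound : (t.*2 <= #|K n|)%N.
  apply: (@leq_trans (turan n k + k * n + 4)%N); first by rewrite /t; lia.
  rewrite -(@leq_pmul2l (2 * k)%N); last by lia.
  have ub := turan_ub n k0.
  have cardK : (2 * k * #|K n| + k * n = k * n ^ 2)%N by rewrite -card_K; ring.
  have n_sq : (2 * k * (k * n) + 8 * k + k * n <= n ^ 2)%N by nia.
  rewrite !mulnDr; lia.
have t_wins : enforcer_wins first (@NC k n) t.
  by apply: enforcer_wins_ub => //; rewrite /t; lia.
apply: (@le_trans _ _ t%:R%:E).
  by apply: ereal_inf_lbound; exists t.
rewrite lee_fin.
have /andP[lb ub] := turan_real_bounds R n k0.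
have /andP[_] := half_bounds R (turan n k + k * n + 4)%N.
rewrite -/t !natrD natrM => hub.
have n1 : 1 <= n%:R :> R by rewrite ler1n; lia.
have Mn : (k%:R / 2 + 2) / delta < n%:R.
  apply: lt_le_trans (_ : M%:R <= _); last by rewrite ler_nat; lia.
  by apply: archi_boundP; rewrite divr_ge0 ?ltW // addr_ge0 // divr_ge0.
rewrite ltr_pdivrMr // in Mn.
have kn : (k%:R / 2 + 2) * n%:R <= delta * n%:R ^+ 2.
  by rewrite expr2 mulrA ler_wpM2r // [delta * _]mulrC ltW.
move: lb kn; set a := (_ - 1) / _; set b := n%:R ^+ 2 => lb kn.
nra.
Qed.
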